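(* Let $K$ be a reproducing kernel on $\mathcal X$ with RKHS $\mathcal H_K$ such that $K(x,x')=\langle\phi_x,\phi_{x'}\rangle_{\mathcal H_1}$ for all $x,x'\in\mathcal X$, where $(Af)(x)=\langle f,\phi_x\rangle_{\mathcal H_1}$. Let $\lambda>0$, let $\psi:[0,+\infty)\to\mathbb R_+$ be continuous, convex and strictly monotonically increasing, and let $$\hat g_{R_y,\lambda}=\arg\min_{g\in\mathcal H_K}R_y(g)+\lambda\psi(\|g\|_{\mathcal H_K}),\qquad \hat f_{R_y,\lambda}=\arg\min_{f\in\mathcal H_1}R_y(Af)+\lambda\psi(\|f\|_{\mathcal H_1})$$ be the Tikhonov regularized solutions of the approximation problem in $\mathcal H_K$ and of the inverse problem $y=Af$. Then $$\hat f_{R_y,\lambda}=\tilde A^{-1}\hat g_{R_y,\lambda}.$$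
   Context: Setting. $\mathcal H_1$ is a real separable Hilbert space, $\mathcal X$ is a Borel space, $\mathcal H_2$ is a real Hilbert space of real-valued functions on $\mathcal X$, and $A:\mathcal H_1\to\mathcal H_2$ is a bounded linear operator for which there is a constant $c>0$ with $|(Af)(x)|\le c\|f\|_{\mathcal H_1}$ for all $x\in\mathcal X$, $f\in\mathcal H_1$. By Riesz' theorem, for every $x$ there is $\phi_x\in\mathcal H_1$ with $(Af)(x)=\langle f,\phi_x\rangle_{\mathcal H_1}$ for all $f$. $\Im(A)$ is the range of $A$. It is known that $\Im(A)$ with norm $\|g\|=\min\{\|w\|_{\mathcal H_1}: w\in\mathcal H_1,\ g(x)=\langle w,\phi_x\rangle_{\mathcal H_1}\ \forall x\in\mathcal X\}$ is the RKHS with kernel $\langle\phi_x,\phi_{x'}\rangle_{\mathcal H_1}$. $\tilde A:=A_{|Ker(A)^\perp}:Ker(A)^\perp\to\Im(A)$, which is a bijection with inverse $\tilde A^{-1}$. Hypotheses on the functional. $y\in\mathcal H_2$ and $\mathcal H_K\subseteq\mathcal H_2$. $R_y:\mathcal H_2\to\mathbb R$ satisfies $R_y(g)\ge0$ for all $g\in\mathcal H_2$, and $R_y(g)=0$ iff $g=y$. If $y\in\mathcal H_K$, $R_y$ is strictly convex. If $y\notin\mathcal H_K$, either (a) $R_y$ is lower semicontinuous, strictly convex and coercive with respect to $\|\cdot\|_{\mathcal H_2}$ and $\mathcal H_K$ is closed in $\mathcal H_2$, or (b) $R_y$ is (on $\mathcal H_K$) lower semicontinuous, strictly convex and coercive with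 respect to $\|\cdot\|_{\mathcal H_K}$. The notation $h=\arg\min$ means that $h$ is the minimizer of the stated problem. *)

(* Defs.v *)
From HB Require Import structures.
From mathcomp Require Import all_boot all_order all_algebra.
From mathcomp Require Import all_classical all_reals all_analysis.
From mathcomp Require Import sesquilinear.

Set Implicit Arguments.
Unset Strict Implicit.
Unset Printing Implicit Defensive.

Import Order.TTheory GRing.Theory Num.Theory.
Import numFieldNormedType.Exports.

Local Open Scope classical_set_scope.
Local Open Scope ring_scope.

HB.mixin Record isHilbert (R : realType) H & CompleteNormedModule R H := {
  inner : {dot H for idfun};
  inner_norm : forall u : H, inner u u = `|u| ^+ 2
}.

#[short(type="hilbertType")]
HB.structure Definition Hilbert (R : realType) :=
  {H of isHilbert R H & CompleteNormedModule R H}.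

(* A Hilbert space of real-valued functions on X is a Hilbert space H whose
   elements are identified with functions through the linear injection feval:
   feval g x is the value g(x).  No continuity of g |-> g(x) is required. *)
HB.mixin Record isFunSpace (R : realType) (X : Type) H & GRing.Lmodule R H := {
  feval : H -> X -> R;
  feval_linear : forall (a : R) (g h : H) (x : X),
    feval (a *: g + h) x = a * feval g x + feval h x;
  feval_inj : injective feval
}.

#[short(type="funHilbertType")]
HB.structure Definition FunHilbert (R : realType) (X : Type) :=
  {H of isFunSpace R X H & Hilbert R H}.

Definition is_separable (T : topologicalType) : Prop :=
  exists2 S : set T, countable S & dense S.

Definition bounded_operator (R : realType) (U V : normedModType R)
    (A : U -> V) : Prop :=
  exists C : R, forall u, `|A u| <= C * `|u|.

Definition ker_perp (R : realType) (H1 : hilbertType R) (V : lmodType R)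
    (A : H1 -> V) : set H1 :=
  [set f | forall h : H1, A h = 0 -> inner f h = 0].

(* The inverse of the restriction of A to (ker A)^perp.  As a total function it
   is meaningful on the image of (ker A)^perp (which is all of range A when A is
   linear and continuous), and takes the default value 0 elsewhere. *)
Definition restr_inv (R : realType) (H1 : hilbertType R) (V : lmodType R)
    (A : H1 -> V) : V -> H1 :=
  ('pinv_(fun=> 0) (ker_perp A) A)%FUN.

Lemma ker_perp_inj (R : realType) (H1 : hilbertType R) (V : lmodType R)
  (A : {linear H1 -> V}) : {in ker_perp A &, injective A}.
Proof.
move=> f g; rewrite !inE => kf kg Afg.
have k0 : A (f - g) = 0 by rewrite linearB/= Afg subrr.
have : inner (f - g) (f - g) = 0 by rewrite linearBl/= (kf _ k0) (kg _ k0) subrr.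
by rewrite inner_norm => /eqP; rewrite sqrf_eq0 normr_eq0 subr_eq0 => /eqP.
Qed.

Lemma restr_invK (R : realType) (H1 : hilbertType R) (V : lmodType R)
  (A : {linear H1 -> V}) (f : H1) : ker_perp A f -> restr_inv A (A f) = f.
Proof.
by move=> kf; rewrite /restr_inv pinvKV ?inE//; exact: ker_perp_inj.
Qed.

Definition is_rkhs (R : realType) (X : Type) (K : X -> X -> R)
    (HK : funHilbertType R X) : Prop :=
  forall x : X, exists2 Kx : HK,
    (forall x', feval Kx x' = K x' x) & (forall g : HK, feval g x = inner g Kx).

Definition strictly_convex (R : realType) (E : lmodType R) (F : E -> R) : Prop :=
  forall (x y : E) (t : R), x != y -> 0 < t < 1 ->
    F (t *: x + (1 - t) *: y) < t * F x + (1 - t) * F y.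

(* F x tends to +oo as the norm of x tends to +oo. *)
Definition coercive (R : realType) (E : normedModType R) (F : E -> R) : Prop :=
  forall M : R, exists r : R, forall x : E, r <= `|x| -> M <= F x.

Definition lsc (R : realType) (T : topologicalType) (F : T -> R) : Prop :=
  lower_semicontinuous (fun x => (F x)%:E).

Definition is_argmin (R : realType) (T : Type) (F : T -> R) (x : T) : Prop :=
  forall z : T, F x <= F z.

(* Main.v *)
Require Import Defs.
From HB Require Import structures.
From mathcomp Require Import all_boot all_order all_algebra.
From mathcomp Require Import all_classical all_reals all_analysis.
From mathcomp Require Import sesquilinear.
From mathcomp Require Import ring lra.

Set Implicit Arguments.
Unset Strict Implicit.
Unset Printing Implicit Defensive.

Import Order.TTheory GRing.Theory Num.Theory.
Import numFieldNormedType.Exports.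

Local Open Scope classical_set_scope.
Local Open Scope ring_scope.

(** Both problems are the same problem seen through the map A.  The vectors
    phi x in H1 and the kernel sections K(., x) in HK have the same Gram matrix,
    so their closed spans are isometric, and under this isometry evaluation at x,
    that is the inner product with phi x respectively with K(., x), is preserved
    ([gram_transfer]).  Applied in both directions this gives two facts: every
    A f is a function of HK of norm at most the norm of f, and every function of
    HK is A f for some f of norm at most its own.

    Since the penalty is an increasing function of the norm, the two minimal costs
    coincide, and the function of HK that represents A fhat is a minimizer in HK.
    The cost in HK is strictly convex in its data term, so this minimizer is ghat
    ([argmin_unique]) and A fhat is ghat.  Finally fhat has the least norm among
    the preimages of ghat, because the data term does not distinguish them; a
    preimage of least norm is orthogonal to the kernel of A
    ([min_norm_ker_perp]), and on that orthogonal complement the restricted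
    inverse undoes A. *)

(** * Inner product and norm *)

Lemma innerC (R : realType) (H : hilbertType R) (u v : H) : inner u v = inner v u.
Proof. by rewrite hermC expr0 mul1r. Qed.

Lemma sqr_normD (R : realType) (H : hilbertType R) (u v : H) :
  `|u + v| ^+ 2 = `|u| ^+ 2 + 2 * inner u v + `|v| ^+ 2.
Proof.
rewrite -!inner_norm linearDl/= !linearDr/= (innerC v u); ring.
Qed.

Lemma inner_le_norm (R : realType) (H : hilbertType R) (u v : H) :
  inner u v <= `|u| * `|v|.
Proof.
have : `|u + v| ^+ 2 <= (`|u| + `|v|) ^+ 2.
  by rewrite ler_pXn2r ?nnegrE ?addr_ge0 ?ler_normD.
rewrite sqr_normD; nra.
Qed.

Lemma norm_inner_le (R : realType) (H : hilbertType R) (u v : H) :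
  `|inner u v| <= `|u| * `|v|.
Proof.
by rewrite ler_norml inner_le_norm andbT lerNl -linearNl/= -(normrN u) inner_le_norm.
Qed.

(** The quantitative form of the fact that a shortest vector of w + span v is
    orthogonal to v: if moving from w along v gains at most e ^+ 2 in squared
    norm, then w is orthogonal to v up to e.  For e = 0 it gives exact
    orthogonality; for e > 0 it does the work of the parallelogram law on
    minimizing sequences. *)
Lemma near_minimal_inner (R : realType) (H : hilbertType R) (w v : H) (e : R) :
    0 <= e -> (forall t : R, `|w| ^+ 2 <= `|w + t *: v| ^+ 2 + e ^+ 2) ->
  `|inner w v| <= e * `|v|.
Proof.
move=> e0 wmin; have [->|v0] := eqVneq v 0; first by rewrite linear0r !normr0 mulr0.
have v2 : 0 < `|v| ^+ 2 by rewrite exprn_gt0// normr_gt0.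
rewrite -(@ler_pXn2r _ 2)// ?nnegrE ?mulr_ge0// real_normK ?num_real// exprMn.
(* this t minimizes the norm of w + t *: v *)
have := wmin (- (inner w v / `|v| ^+ 2)).
rewrite sqr_normD linearZr_LR/= normrZ exprMn real_normK ?num_real//.
set i := inner w v; set q := `|v| ^+ 2 in v2 *.
have -> : `|w| ^+ 2 + 2 * (- (i / q) * i) + (- (i / q)) ^+ 2 * q + e ^+ 2
   = `|w| ^+ 2 + (e ^+ 2 - i ^+ 2 / q) by field; rewrite gt_eqF.
by rewrite lerDl subr_ge0 ler_pdivrMr.
Qed.

(** * Transfer between spaces with the same Gram matrix *)

(** A combination is a formal list of coefficients and indices, so that the same
    list can be evaluated on two families of vectors; this is how the isometry
    between their spans is expressed, without well-definedness obligations. *)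
Definition lcomb (R : realType) (X : Type) (V : lmodType R) (a : X -> V)
    (s : seq (R * X)) : V := \sum_(p <- s) p.1 *: a p.2.

Lemma lcomb_cat (R : realType) (X : Type) (V : lmodType R) (a : X -> V) s t :
  lcomb a (s ++ t) = lcomb a s + lcomb a t.
Proof. exact: big_cat. Qed.

Lemma lcomb_scale (R : realType) (X : Type) (V : lmodType R) (a : X -> V) c s :
  lcomb a [seq (c * p.1, p.2) | p <- s] = c *: lcomb a s.
Proof.
by rewrite /lcomb big_map scaler_sumr; apply: eq_bigr => p _; rewrite scalerA.
Qed.

Lemma lcomb1 (R : realType) (X : Type) (V : lmodType R) (a : X -> V) x :
  lcomb a [:: (1, x)] = a x.
Proof. by rewrite /lcomb big_seq1 scale1r. Qed.

Lemma lcomb_gram (R : realType) (X : Type) (H H' : hilbertType R)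
    (phi : X -> H) (k : X -> H') s t :
    (forall x x', inner (phi x) (phi x') = inner (k x) (k x')) ->
  inner (lcomb phi s) (lcomb phi t) = inner (lcomb k s) (lcomb k t).
Proof.
move=> gram; rewrite !linear_sumlz; apply: eq_bigr => p _.
rewrite !linear_sumr; apply: eq_bigr => q _.
by rewrite !(linearZl_LR, linearZr_LR)/= gram.
Qed.

Lemma inner_cvgl (R : realType) (H : hilbertType R) (u : H ^nat) (g v : H) :
  u @ \oo --> g -> (fun n => inner (u n) v) @ \oo --> inner g v.
Proof.
move=> ug; apply/cvgrPdist_le => e e0; near=> n.
rewrite -linearBl/=; apply: le_trans (norm_inner_le _ _) _.
have v1 : 0 < `|v| + 1 by rewrite ltr_wpDl.
apply: (@le_trans _ _ (`|g - u n| * (`|v| + 1))).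
  by rewrite ler_wpM2l// lerDl.
rewrite -ler_pdivlMr//; near: n.
by move/cvgrPdist_le: ug; apply; rewrite divr_gt0.
Unshelve. all: by end_near. Qed.

(** Evaluating lists on phi and on k gives isometric spans.  The vector g
    is the image, under the extension of this isometry to the closed spans, of
    the orthogonal projection of f on the closed span of phi.  It is obtained
    directly: take lists s n whose values on phi approach the distance of f to
    the span; by near-orthogonality of the residuals these values are Cauchy,
    so the values on k are Cauchy too, and g is their limit. *)
Lemma gram_transfer (R : realType) (X : Type) (H H' : hilbertType R)
    (phi : X -> H) (k : X -> H') (f : H) :
    (forall x x', inner (phi x) (phi x') = inner (k x) (k x')) ->
  exists2 g : H', `|g| <= `|f| & forall x, inner g (k x) = inner f (phi x).
Proof.
move=> gram.
pose E := [set `|f - lcomb phi s| ^+ 2 | s in [set: seq (R * X)]].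
have Elb : lbound E 0 by move=> _ [s _ <-]; exact: sqr_ge0.
have Einf : has_inf E by split; [exists (`|f - lcomb phi [::]| ^+ 2), [::]|exists 0].
have infE s : inf E <= `|f - lcomb phi s| ^+ 2.
  by apply: ge_inf; [exists 0|exists s].
have /choice[s sP] (n : nat) :
    exists s, `|f - lcomb phi s| ^+ 2 < inf E + n.+1%:R^-1 ^+ 2 :> R.
  have [|_ [s _ <-] ?] := @inf_adherent _ E (n.+1%:R^-1 ^+ 2) _ Einf.
    by rewrite exprn_gt0.
  by exists s.
(* the residual is almost orthogonal to the whole span of phi, because the
   competitors s n ++ (- c) t are lists again *)
have orth n t : `|inner (f - lcomb phi (s n)) (lcomb phi t)|
    <= n.+1%:R^-1 * `|lcomb phi t|.
  apply: near_minimal_inner => // c; apply: le_trans (ltW (sP n)) _.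
  rewrite lerD2r (le_trans (infE (s n ++ [seq ((- c) * p.1, p.2) | p <- t])))//.
  by rewrite lcomb_cat lcomb_scale scaleNr opprD opprK addrA.
have norm_k t : `|lcomb k t| = `|lcomb phi t|.
  by apply/eqP; rewrite -(@eqrXn2 _ 2)// -!inner_norm (lcomb_gram _ _ gram).
have normB m n : `|lcomb k (s m) - lcomb k (s n)| <= m.+1%:R^-1 + n.+1%:R^-1.
  pose t := s m ++ [seq ((-1) * p.1, p.2) | p <- s n].
  have tE (V : lmodType R) (a : X -> V) : lcomb a t = lcomb a (s m) - lcomb a (s n).
    by rewrite lcomb_cat lcomb_scale scaleN1r.
  rewrite -tE norm_k.
  have [->|t0] := eqVneq (lcomb phi t) 0; first by rewrite normr0 addr_ge0.
  have tpos : 0 < `|lcomb phi t| by rewrite normr_gt0.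
  rewrite -(ler_pM2r tpos) -expr2 -inner_norm {1}tE.
  (* a difference of two approximants is a difference of two residuals, each
     almost orthogonal to that same difference *)
  have -> : lcomb phi (s m) - lcomb phi (s n) =
     (f - lcomb phi (s n)) - (f - lcomb phi (s m)).
    by rewrite opprB [RHS]addrC addrA subrK.
  rewrite linearBl/= mulrDl.
  move: (orth m t) (orth n t); rewrite !ler_norml => /andP[orthm _] /andP[_ orthn].
  by rewrite addrC lerD// lerNl.
have harm0 : (fun n => n.+1%:R^-1 : R) @ \oo --> 0 by exact: cvg_harmonic.
have : cvg ((fun n => lcomb k (s n)) @ \oo).
  apply/cauchy_cvgP/cauchy_exP => e e0.
  have e20 : 0 < e / 2 by rewrite divr_gt0.
  have small : \forall n \near \oo, n.+1%:R^-1 < e / 2.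
    by exact: (cvgr_lt _ harm0 _ e20).
  have [N _ smallN] := small; exists (lcomb k (s N)).
  exists N => // n Nn; rewrite -ball_normE/=.
  apply: le_lt_trans (normB _ _) _; rewrite [ltRHS]splitr.
  by rewrite ltrD// smallN/=.
move=> /cvg_ex[g vg]; exists g => [|x].
  have nv : (fun n => `|lcomb k (s n)|) @ \oo --> `|g| by exact: cvg_norm vg.
  have nf : (fun n => `|f| + n.+1%:R^-1) @ \oo --> `|f|.
    by rewrite -[X in _ --> X]addr0; apply: cvgD harm0; exact: cvg_cst.
  apply: ler_cvg_to nv nf _; apply: nearW => n; rewrite norm_k.
  set u := lcomb phi (s n).
  have [->|u0] := eqVneq u 0; first by rewrite normr0 addr_ge0.
  have upos : 0 < `|u| by rewrite normr_gt0.
  rewrite -(ler_pM2r upos) -expr2 -inner_norm.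
  (* |u|^2 is <f, u> up to the almost vanishing product of the residual and u *)
  have -> : inner u u = inner f u - inner (f - u) u by rewrite linearBl/= subKr.
  have := orth n (s n); rewrite ler_norml => /andP[orthn _].
  by rewrite mulrDl lerD ?inner_le_norm// lerNl.
apply: (cvg_unique (@Rhausdorff R) (inner_cvgl (v := k x) vg)).
have lim0 : (fun n => n.+1%:R^-1 * `|phi x|) @ \oo --> (0 : R).
  by rewrite -[X in _ --> X](mul0r `|phi x|); apply: cvgMr_tmp.
apply/cvgrPdist_le => e e0.
apply: filterS (cvgr_lt _ lim0 _ e0) => n small_n; apply: le_trans _ (ltW small_n).
rewrite -[k x]lcomb1 -(lcomb_gram _ _ gram) lcomb1 -linearBl/=.
by have := orth n [:: (1, x)]; rewrite lcomb1.
Qed.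

(** * Minimizers *)

(** Moving f along the kernel does not change A f, so it cannot shorten f; this
    is exact orthogonality, the case e = 0 of [near_minimal_inner]. *)
Lemma min_norm_ker_perp (R : realType) (H1 : hilbertType R) (V : lmodType R)
    (A : {linear H1 -> V}) (f : H1) :
  (forall f', A f' = A f -> `|f| <= `|f'|) -> ker_perp A f.
Proof.
move=> fmin h Ah; apply/eqP; rewrite -normr_le0 -(mul0r `|h|).
apply: near_minimal_inner => // t; rewrite expr0n/= addr0.
rewrite ler_pXn2r ?nnegrE//; apply: fmin.
by rewrite linearD linearZ/= Ah scaler0 addr0.
Qed.

(** Two minimizers that differ would both be beaten by their midpoint: the data
    term gains strictly, and the penalty cannot lose since psi is monotone and
    convex. *)
Lemma argmin_unique (R : realType) (E : normedModType R) (F : E -> R)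
    (lambda : R) (psi : R -> R) (g h : E) :
    strictly_convex F -> 0 <= lambda ->
    @convex_function R R^o `[0, +oo[ psi ->
    {in `[0, +oo[ &, {homo psi : s t / s < t}} ->
    is_argmin (fun z => F z + lambda * psi `|z|) g ->
    is_argmin (fun z => F z + lambda * psi `|z|) h ->
  g = h.
Proof.
move=> Fconv lambda0 psiconv psiincr gmin hmin; apply/eqP/negPn/negP => gh.
have half0 : 0 <= 2^-1 :> R by [].
have half1 : 2^-1 <= 1 :> R by rewrite invf_le1// ler1n.
have halfC : 1 - 2^-1 = 2^-1 :> R by rewrite [X in X - _](splitr 1) mul1r addrK.
have halflt1 : (2^-1 < 1 :> R) by rewrite invf_lt1// ltr1n.
have halfin : 0 < (2^-1 : R) < 1 by rewrite invr_gt0 ltr0n halflt1.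
have psile : {in `[0, +oo[ &, {homo psi : s t / s <= t}}.
  move=> s t s0 t0; rewrite le_eqVlt => /predU1P[->//|st].
  exact/ltW/psiincr.
have inI (z : R) : 0 <= z -> z \in `[0, +oo[ by move=> z0; rewrite in_itv/= z0.
pose m := 2^-1 *: g + (1 - 2^-1) *: h.
have Fm : F m < 2^-1 * F g + (1 - 2^-1) * F h by exact: Fconv.
have nm : `|m| <= 2^-1 * `|g| + (1 - 2^-1) * `|h|.
  by rewrite (le_trans (ler_normD _ _))// !normrZ halfC ger0_norm.
have psim : psi `|m| <= 2^-1 * psi `|g| + (1 - 2^-1) * psi `|h|.
  apply: le_trans (psile _ _ _ _ nm) _; rewrite ?inI// ?halfC ?addr_ge0 ?mulr_ge0//.
  rewrite -[X in psi (_ + X * _)]halfC -[X in _ <= _ + X * _]halfC.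
  by apply: (psiconv (Itv01 half0 half1) `|g| `|h|); rewrite inE/= in_itv/= normr_ge0.
have lm : lambda * psi `|m|
    <= 2^-1 * (lambda * psi `|g|) + (1 - 2^-1) * (lambda * psi `|h|).
  by rewrite (mulrCA 2^-1) (mulrCA (1 - 2^-1)) -mulrDr ler_wpM2l.
move: (gmin m) (hmin m) Fm lm; rewrite !halfC.
move: (F m) (F g) (F h) (lambda * _) (lambda * _) (lambda * _) => a b c p q r.
lra.
Qed.

Lemma strictly_convex_comp (R : realType) (E V : lmodType R) (L : E -> V)
    (F : V -> R) : linear L -> injective L -> strictly_convex F ->
  strictly_convex (F \o L).
Proof.
move=> Llin Linj Fconv x y t xy t01 /=.
have L0 : L 0 = 0 by have := Llin (-1) 0 0; rewrite !scaleN1r oppr0 addr0 addNr.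
have LZ c z : L (c *: z) = c *: L z by rewrite -[c *: z]addr0 Llin L0 addr0.
by rewrite Llin LZ; apply: Fconv => //; rewrite (inj_eq Linj).
Qed.

Theorem theorem2 (R : realType)
  (* the Borel space X, with sigma-algebra SX *)
  (X : Type) (SX : set (set X)) (hSX : sigma_algebra setT SX)
  (H1 : hilbertType R) (hsep : is_separable H1)
  (H2 : funHilbertType R X)
  (A : {linear H1 -> H2}) (hA : bounded_operator A)
  (c : R) (hc : 0 < c)
  (hAc : forall (x : X) (f : H1), `|feval (A f) x| <= c * `|f|)
  (phi : X -> H1)
  (hphi : forall (f : H1) (x : X), feval (A f) x = inner f (phi x))
  (K : X -> X -> R) (HK : funHilbertType R X) (hHK : is_rkhs K HK)
  (hK : forall x x' : X, K x x' = inner (phi x) (phi x'))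
  (* HK is contained in H2: incl is the inclusion map *)
  (incl : HK -> H2) (hincl : forall g : HK, feval (incl g) =1 feval g)
  (y : H2) (Ry : H2 -> R)
  (hRy_ge0 : forall g : H2, 0 <= Ry g)
  (hRy_eq0 : forall g : H2, Ry g = 0 <-> g = y)
  (hRy_in : range incl y -> strictly_convex Ry)
  (hRy_out : ~ range incl y ->
     (lsc Ry /\ strictly_convex Ry /\ coercive Ry /\ closed (range incl)) \/
     (lsc (Ry \o incl) /\ strictly_convex (Ry \o incl) /\
      coercive (Ry \o incl)))
  (lambda : R) (hlambda : 0 < lambda)
  (* psi is only considered on [0, +oo[ *)
  (psi : R -> R)
  (hpsi_ge0 : forall t : R, 0 <= t -> 0 <= psi t)
  (hpsi_cont : {within `[0, +oo[, continuous psi})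
  (hpsi_convex : @convex_function R R^o `[0, +oo[ psi)
  (hpsi_incr : {in `[0, +oo[ &, {homo psi : s t / s < t}})
  (ghat : HK)
  (hghat : is_argmin (fun g : HK => Ry (incl g) + lambda * psi `|g|) ghat)
  (fhat : H1)
  (hfhat : is_argmin (fun f : H1 => Ry (A f) + lambda * psi `|f|) fhat) :
  (A @` ker_perp A) (incl ghat) /\ fhat = restr_inv A (incl ghat).
Proof.
have [Kx Kval Krep] : exists2 Kx : X -> HK,
    forall x x', feval (Kx x) x' = K x' x & forall g x, feval g x = inner g (Kx x).
  have /choice[Kx Kxp] : forall x, exists Kx : HK,
      (forall x', feval Kx x' = K x' x) /\ forall g : HK, feval g x = inner g Kx.
    by move=> x; have [Kx] := hHK x; exists Kx.
  by exists Kx => [x x'|g x]; have [] := Kxp x.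
have gram x x' : inner (phi x) (phi x') = inner (Kx x) (Kx x').
  by rewrite -Krep Kval hK innerC.
have inclE g f : (forall x, inner g (Kx x) = inner f (phi x)) -> incl g = A f.
  by move=> gf; apply/(feval_inj (s := H2))/funext => x; rewrite hincl Krep gf hphi.
have to_HK f : exists2 g, `|g| <= `|f| & incl g = A f.
  by have [g gf /inclE] := gram_transfer f gram; exists g.
have to_H1 g : exists2 f, `|f| <= `|g| & incl g = A f.
  have [f fg gf] := gram_transfer g (fun x x' => esym (gram x x')).
  by exists f => //; exact: inclE.
have inclI : injective incl.
  move=> g h gh; apply/(feval_inj (s := HK))/funext => x.
  by rewrite -!hincl gh.
have incl_lin : linear incl.
  move=> a g h; apply/(feval_inj (s := H2))/funext => x.
  by rewrite hincl !feval_linear !hincl.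
have Rconv : strictly_convex (Ry \o incl).
  have [yin|yout] := pselect (range incl y).
    by apply: strictly_convex_comp (hRy_in yin).
  case: (hRy_out yout) => [[_ [+ _]]|[_ [+ _]]] //.
  by apply: strictly_convex_comp.
have inI (V : normedModType R) (z : V) : `|z| \in `[0, +oo[ by rewrite in_itv/= normr_ge0.
have psi_mono : {in `[0, +oo[ &, {mono psi : s t / s <= t}} by exact: le_mono_in.
have [f0 f0g f0E] := to_H1 ghat.
have [g gf gE] := to_HK fhat.
have costg : Ry (incl g) + lambda * psi `|g| <= Ry (A fhat) + lambda * psi `|fhat|.
  by rewrite gE lerD2l ler_pM2l// psi_mono ?inI.
have costf0 : Ry (A f0) + lambda * psi `|f0| <= Ry (incl ghat) + lambda * psi `|ghat|.
  by rewrite f0E lerD2l ler_pM2l// psi_mono ?inI.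
(* f0 carries the optimality of ghat over to H1: the cost of fhat is at most
   that of f0, hence at most the minimal cost in HK *)
have gmin : is_argmin (fun g : HK => Ry (incl g) + lambda * psi `|g|) g.
  move=> z; apply: le_trans costg _; apply: le_trans (hfhat f0) _.
  exact: le_trans costf0 (hghat z).
have Eg : g = ghat.
  exact: (argmin_unique Rconv (ltW hlambda) hpsi_convex hpsi_incr gmin hghat).
(* among the preimages of A fhat the data term is constant, so the penalty
   alone makes fhat the one of least norm *)
have fperp : ker_perp A fhat.
  apply: min_norm_ker_perp => f' Af'.
  by have := hfhat f'; rewrite Af' lerD2l ler_pM2l// psi_mono ?inI.
have Afhat : incl ghat = A fhat by rewrite -Eg.
by rewrite Afhat restr_invK//; split=> //; exists fhat.
Qed.
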